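(* Let $v$ be the collective Llull matrix of a vote on a finite set $A$, and let $X$ be a nonempty proper subset of $A$, $Y=A\setminus X$. Let $(\varphi_x)_{x\in A}$ be the fraction-like rates determined by $v$ and $(\tilde\varphi_x)_{x\in X}$ those determined by the restricted Llull matrix $(v_{x\bar x})_{x,\bar x\in X}$ on $X$. Consider the following two conditions: (P) $v_{xy}=1$ for all $x\in X$, $y\in Y$, and no nonempty proper subset $\hat X\subset X$ satisfies $v_{xy}=1$ for all $x\in\hat X$, $y\in A\setminus\hat X$; (Q) $\varphi_x=\tilde\varphi_x>0$ for all $x\in X$ and $\varphi_y=0$ for all $y\in Y$. (a) If either $v$ is complete ($v_{xy}+v_{yx}=1$ for all $x\neq y$), or the individual votes are rankings (possibly truncated and with ties), then (P) implies (Q). (b) If $v$ is complete, then (Q) implies (P).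
   Context: Let $A$ be a finite set with $N\ge1$ elements and $\Pi$ the set of ordered pairs $xy$ with $x,y\in A$, $x\ne y$. A relation on $A$ is a subset of $\Pi$. A Llull matrix on $A$ is a family $v=(v_{xy})_{xy\in\Pi}$ with $v_{xy}\in[0,1]$ and $v_{xy}+v_{yx}\le1$. Turnovers: $t_{xy}=v_{xy}+v_{yx}$. The collective Llull matrix of a vote is $v=\sum_k\alpha_kv^k$, where $v^k$ are the (finitely many) Llull matrices of the individual votes and $\alpha_k>0$, $\sum_k\alpha_k=1$, their weights. The votes being rankings means: each vote $k$ consists of a list $L\subseteq A$ ranked by a complete ranking (ties allowed), and $v^k_{xy}=1$ if $x,y\in L$ with $x$ ranked strictly above $y$, or $x\in L$, $y\notin L$; $v^k_{xy}=1/2$ if $x,y\in L$ are tied; $v^k_{xy}=0$ otherwise. Indirect scores: $v^*_{xy}=\max\min_{0\le i<n}v_{x_ix_{i+1}}$, the max being over all paths $x_0x_1\dots x_n$ ($n\ge1$, consecutive elements distinct) with $x_0=x$, $x_n=y$. Put $m^\nu_{xy}=v^*_{xy}-v^*_{yx}$, $\nu=\{xy\in\Pi: m^\nu_{xy}>0\}$, $\hat\nu=\{xy\in\Pi: m^\nu_{xy}\ge0\}$. An admissible order is a (strict) total order $\xi\subseteq\Pi$ with $\nu\subseteq\xi\subseteq\hat\nu$; one always exists. Write $x\succ y$ for $xy\in\xi$, $x\succeq y$ for $x\succ y$ or $x=y$, and $x'$ for the immediate successor of $x$ in $\xi$ (for $x$ not last). Given an admissible order $\xi$, the projected scores are obtained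 as follows. (i) For $x\succ y$: $m^\sigma_{xy}=\min\{m^\nu_{pq}: p\succeq x,\ y\succeq q\}$. (ii) $(t^\sigma_{xy})_{xy\in\Pi}$ is the unique minimizer of $\sum_{xy\in\Pi}(\tau_{xy}-t_{xy})^2$ among all real families $(\tau_{xy})_{xy\in\Pi}$ such that $\tau_{xy}=\tau_{yx}$ for all $xy$; $m^\sigma_{xx'}\le\tau_{xx'}\le1$ for all non-last $x$; $0\le\tau_{xy}-\tau_{xy'}\le m^\sigma_{yy'}$ for all non-last $y$ and all $x\notin\{y,y'\}$. (iii) $\gamma_{xx'}=[(t^\sigma_{xx'}-m^\sigma_{xx'})/2,\ (t^\sigma_{xx'}+m^\sigma_{xx'})/2]$, and for $x\succ y$, $\gamma_{xy}=\bigcup\{\gamma_{pp'}: x\succeq p\succ y\}$, which is a closed interval. (iv) For $x\succ y$: $v^\pi_{xy}=\max\gamma_{xy}$, $v^\pi_{yx}=\min\gamma_{xy}$. The projected scores do not depend on the choice of $\xi$. Put $t^\pi_{xy}=v^\pi_{xy}+v^\pi_{yx}$. Fraction-like rates: their sum $f$ is the fraction of non-empty votes; in all situations of the claim $f=1$, both for $v$ and for its restriction to $X$. If $N=1$ the only rate equals $f$. If $N\ge2$ and $(v^\pi_{xy})\ne0$: there is a unique nonempty set $Z\subseteq A$ (the top dominant irreducible component of $(v^\pi_{xy})$) such that any two distinct elements of $Z$ can be joined in both directions by paths along which $v^\pi>0$, every $y\notin Z$ can be reached from every $z\in Z$ by such a path, and no $z\in Z$ can be reached by such a path from any $y\notin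 Z$. Then $\varphi_x=0$ for $x\notin Z$, and $(\varphi_x)_{x\in Z}$ is the unique family of positive numbers with $\sum_{x\in Z}\varphi_x=f$ and $\sum_{y\in Z,\,y\ne x}t^\pi_{xy}\,\varphi_x/(\varphi_x+\varphi_y)=\sum_{y\in Z,\,y\neq x}v^\pi_{xy}$ for all $x\in Z$. For a Llull matrix on a subset of $A$ the same procedure is applied with $A$ replaced by that subset. *)

(* Defs.v *)
From mathcomp Require Import all_boot all_order all_algebra.
From mathcomp Require Import all_classical all_reals.

Set Implicit Arguments.
Unset Strict Implicit.
Unset Printing Implicit Defensive.

Import Order.TTheory GRing.Theory Num.Theory.

Local Open Scope ring_scope.

(* A family indexed by the ordered pairs of distinct elements of [A] is
   represented by a function [A -> A -> R] whose diagonal values are never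
   used. *)

Section Votes.
Context {R : realType} {A : finType}.
Implicit Types (v w : A -> A -> R).

Definition llull v :=
  forall x y, x != y -> 0 <= v x y <= 1 /\ v x y + v y x <= 1.

Definition collective (K : finType) (alpha : K -> R) (w : K -> A -> A -> R) :=
  fun x y => \sum_(k : K) alpha k * w k x y.

Definition complete v := forall x y, x != y -> v x y + v y x = 1.

(* [r x y] reads "x is ranked at least as high as y"; it is only relevant on
   the list [L]. *)
Definition ranking_score (L : {set A}) (r : rel A) (x y : A) : R :=
  if x \in L then
    if y \in L then
      if r x y then if r y x then 1 / 2 else 1 else 0
    else 1
  else 0.

Definition ranking_vote w :=
  exists (L : {set A}) (r : rel A),
    [/\ {in L &, total r}, {in L & &, transitive r}
      & forall x y, x != y -> w x y = ranking_score L r x y].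

Definition restrict (X : {set A}) v :
    {x : A | x \in X} -> {x : A | x \in X} -> R :=
  fun x y => v (val x) (val y).

End Votes.

Section Projection.
Context {R : realType} {A : finType}.
Implicit Types (v t tau : A -> A -> R) (xi : rel A).

Definition turnover v : A -> A -> R := fun x y => v x y + v y x.

(* The path is x :: s with s nonempty; the default value 1 is harmless since
   the entries of a Llull matrix are at most 1. *)
Definition path_score v (x : A) (s : seq A) : R :=
  \big[Num.min/1]_(c <- pairmap v x s) c.

(* The path scores take finitely many values, so this supremum is a maximum
   (for x != y). *)
Definition indirect v (x y : A) : R :=
  sup [set path_score v x s | s in
        [set s : seq A | [&& s != [::], path (fun a b => a != b) x s
                           & last x s == y]]]%classic.

Definition margin v (x y : A) : R := indirect v x y - indirect v y x.

Definition admissible v xi :=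
  [/\ irreflexive xi, transitive xi,
      forall x y, x != y -> xi x y || xi y x,
      forall x y, x != y -> 0 < margin v x y -> xi x y
    & forall x y, xi x y -> 0 <= margin v x y].

Definition weakly xi (x y : A) := (x == y) || xi x y.

Definition isucc xi (x y : A) := xi x y && [forall z, ~~ (xi x z && xi z y)].

(* Meant for xi x y; the default value is the term of the pair (x, y), which
   belongs to the range. *)
Definition proj_margin v xi (x y : A) : R :=
  \big[Num.min/margin v x y]_(pq : A * A | weakly xi pq.1 x && weakly xi y pq.2)
    margin v pq.1 pq.2.

Definition feasible v xi tau :=
  [/\ forall x y, x != y -> tau x y = tau y x,
      forall x x', isucc xi x x' -> proj_margin v xi x x' <= tau x x' <= 1
    & forall x y y', isucc xi y y' -> x != y -> x != y' ->
        0 <= tau x y - tau x y' <= proj_margin v xi y y'].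

Definition sq_dist t tau : R :=
  \sum_(x : A) \sum_(y : A | y != x) (tau x y - t x y) ^+ 2.

Definition proj_turnover v xi tau :=
  feasible v xi tau /\
  forall tau', feasible v xi tau' ->
    sq_dist (turnover v) tau <= sq_dist (turnover v) tau'.

Definition gamma v xi tau (x y : A) : set R :=
  (\bigcup_(pq in [set pq : A * A | [&& weakly xi x pq.1, xi pq.1 y
                                      & isucc xi pq.1 pq.2]])
     [set` `[(tau pq.1 pq.2 - proj_margin v xi pq.1 pq.2) / 2,
             (tau pq.1 pq.2 + proj_margin v xi pq.1 pq.2) / 2]])%classic.

(* gamma is a nonempty finite union of compact intervals, so the supremum and
   the infimum are attained. *)
Definition proj_of v xi tau (x y : A) : R :=
  if xi x y then sup (gamma v xi tau x y) else inf (gamma v xi tau y x).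

Definition projected v (vpi : A -> A -> R) :=
  exists (xi : rel A) (tau : A -> A -> R),
    [/\ admissible v xi, proj_turnover v xi tau
      & forall x y, x != y -> vpi x y = proj_of v xi tau x y].

End Projection.

Section Rates.
Context {R : realType} {A : finType}.
Implicit Types (v vpi : A -> A -> R) (Z : {set A}) (phi : A -> R).

Definition reach vpi := connect (fun a b : A => (a != b) && (0 < vpi a b)).

Definition top_component vpi Z :=
  [/\ (0 < #|Z|)%N,
      forall x y, x \in Z -> y \in Z -> x != y -> reach vpi x y,
      forall z y, z \in Z -> y \notin Z -> reach vpi z y
    & forall z y, z \in Z -> y \notin Z -> ~~ reach vpi y z].

Definition rates_on (f : R) vpi Z phi :=
  [/\ forall x, x \notin Z -> phi x = 0,
      forall x, x \in Z -> 0 < phi x,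
      \sum_(x in Z) phi x = f
    & forall x, x \in Z ->
        \sum_(y in Z | y != x) turnover vpi x y * (phi x / (phi x + phi y))
        = \sum_(y in Z | y != x) vpi x y].

(* [rates f v phi]: phi is the family of fraction-like rates, of sum f,
   determined by v.  Nothing satisfies this when #|A| > 1 and the projected
   scores vanish identically. *)
Definition rates (f : R) v phi :=
  (#|A| = 1 /\ forall x, phi x = f) \/
  ((1 < #|A|)%N /\
   exists vpi Z,
     [/\ projected v vpi, exists x y, x != y /\ vpi x y <> 0,
         top_component vpi Z & rates_on f vpi Z phi]).

End Rates.

Section Conditions.
Context {R : realType} {A : finType}.

Definition unanimous (v : A -> A -> R) (X : {set A}) :=
  forall x y, x \in X -> y \notin X -> v x y = 1.

Definition condP (v : A -> A -> R) (X : {set A}) :=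
  unanimous v X /\
  ~ exists X' : {set A}, [/\ (0 < #|X'|)%N, X' \proper X & unanimous v X'].

Definition condQ (X : {set A}) (phi : A -> R) (phiX : {x : A | x \in X} -> R) :=
  (forall x : {x : A | x \in X}, phi (val x) = phiX x /\ 0 < phiX x) /\
  (forall y, y \notin X -> phi y = 0).

End Conditions.

(* Main.v *)
(* For [x], [y] let [M x y] ([separation]) be the largest [c] in [[0, 1]] such
   that some set containing [x] but not [y] has all its outgoing margins at
   least [c] ([0] if there is none). When [X] is unanimous and all the turnovers
   inside [X] and between [X] and its complement equal 1 (which either
   hypothesis on the votes implies), the projected turnovers involving [X] equal
   1, because raising them to 1 preserves feasibility. A set with positive
   outgoing margins is an initial segment of every admissible order, so on [X]
   the projected scores are [(1 + M x y - M y x) / 2] for any admissible order,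
   and they vanish from the complement of [X] to [X]. Paths leaving [X] cannot
   come back with a positive score, so [M] is the same for [v] and for its
   restriction to [X]. An unreachable pair inside [X] has [M = 1], which yields
   a smaller unanimous set; thus (P) makes [X] the top component of both
   problems, and uniqueness of Zermelo's rates gives (Q). In the complete case
   the same formula on the whole of [A] shows that the top component is
   unanimous and minimal. *)

Require Import Defs.
From mathcomp Require Import boolp classical_sets.
From mathcomp Require Import all_boot all_order all_algebra.
From mathcomp Require Import reals.
From mathcomp Require Import ring lra.

Set Implicit Arguments.
Unset Strict Implicit.
Unset Printing Implicit Defensive.

Import Order.TTheory GRing.Theory Num.Theory.

Local Open Scope ring_scope.

(** * Paths, indirect scores and margins of a Llull matrix *)

Section IndirectScores.
Context {R : realType} {A : finType}.
Implicit Types (v : A -> A -> R) (U X : {set A}).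

Lemma llull_ge0 v x y : llull v -> x != y -> 0 <= v x y.
Proof. by move=> vL /vL[/andP[]]. Qed.

Lemma llull_le1 v x y : llull v -> x != y -> v x y <= 1.
Proof. by move=> vL /vL[/andP[]]. Qed.

Lemma path_score_cons v x y s :
  path_score v x (y :: s) = Num.min (v x y) (path_score v y s).
Proof. by rewrite /path_score /= big_cons. Qed.

Lemma path_score_le1 v x s : path_score v x s <= 1.
Proof.
elim: s x => [|y s IHs] x; first by rewrite /path_score big_nil.
by rewrite path_score_cons ge_min IHs orbT.
Qed.

Lemma indirect_ge v x y s :
  s != [::] -> path (fun a b => a != b) x s -> last x s = y ->
  path_score v x s <= indirect v x y.
Proof.
move=> s0 ps ls; apply: ub_le_sup.
  by exists 1 => _ [t _ <-]; exact: path_score_le1.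
by exists s => //=; rewrite s0 ps ls eqxx.
Qed.

Lemma indirect_le v x y c : x != y ->
  (forall s, path (fun a b => a != b) x s -> last x s = y ->
     path_score v x s <= c) ->
  indirect v x y <= c.
Proof.
move=> xy sc; apply: ge_sup.
  by exists (path_score v x [:: y]), [:: y]; rewrite //= xy eqxx.
by move=> _ [s /= /and3P[_ ps /eqP ls] <-]; exact: sc.
Qed.

Lemma indirect_direct v x y : llull v -> x != y -> v x y <= indirect v x y.
Proof.
move=> vL xy; apply: le_trans (@indirect_ge v x y [:: y] _ _ _); rewrite //= ?xy //.
by rewrite path_score_cons /path_score big_nil /= le_min lexx llull_le1.
Qed.

Lemma indirect_le1 v x y : x != y -> indirect v x y <= 1.
Proof. by move=> xy; apply: indirect_le => // s _ _; exact: path_score_le1. Qed.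

Lemma indirect_ge0 v x y : llull v -> x != y -> 0 <= indirect v x y.
Proof. by move=> vL xy; apply: le_trans (indirect_direct vL xy); apply: llull_ge0. Qed.

(** Some step of the path enters [U], and the minimum is at most the entry of that step. *)
Lemma path_score_enter v U x s :
  (forall a b, a \in U -> b \notin U -> v b a <= 0) ->
  x \notin U -> last x s \in U -> path_score v x s <= 0.
Proof.
move=> vU; elim: s x => [|y s IHs] x xU /=; first by rewrite (negPf xU).
move=> ls; rewrite path_score_cons ge_min.
have [yU|yU] := boolP (y \in U); first by rewrite vU.
by rewrite IHs ?orbT.
Qed.

Lemma unanimous_opp v U x y :
  llull v -> unanimous v U -> x \in U -> y \notin U -> v y x = 0.
Proof.
move=> vL vU xU yU; have xy : x != y by apply: contraNneq yU => <-.
have [_] := vL _ _ xy; have := vU _ _ xU yU.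
have : 0 <= v y x by apply: llull_ge0; rewrite // eq_sym.
lra.
Qed.

Lemma unanimous_indirect0 v U x y :
  llull v -> unanimous v U -> x \in U -> y \notin U -> indirect v y x = 0.
Proof.
move=> vL vU xU yU; have yx : y != x by apply: contraNneq yU => ->.
apply/eqP; rewrite eq_le indirect_ge0 // andbT; apply: indirect_le => // s _ ls.
apply: (@path_score_enter _ U) => //; last by rewrite ls.
by move=> a b aU bU; rewrite (unanimous_opp vL vU).
Qed.

Lemma unanimous_margin v U x y :
  llull v -> unanimous v U -> x \in U -> y \notin U -> margin v x y = 1.
Proof.
move=> vL vU xU yU; have xy : x != y by apply: contraNneq yU => <-.
rewrite /margin (unanimous_indirect0 vL vU xU yU) subr0.
apply/eqP; rewrite eq_le indirect_le1 //=.
by have := indirect_direct vL xy; rewrite (vU _ _ xU yU).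
Qed.

(** A difference of two numbers in [0, 1] reaches 1 only if the second one, which bounds [v y x]
    from above, vanishes. *)
Lemma margin_ge1_opp v x y :
  llull v -> x != y -> 1 <= margin v x y -> v y x = 0.
Proof.
move=> vL xy; rewrite /margin.
have := indirect_le1 v xy; have yx : y != x by rewrite eq_sym.
have := indirect_direct vL yx; have := llull_ge0 vL yx; lra.
Qed.

Lemma marginC v x y : margin v y x = - margin v x y.
Proof. by rewrite /margin opprB. Qed.

Lemma margin_le1 v x y : llull v -> x != y -> margin v x y <= 1.
Proof.
move=> vL xy; rewrite /margin; have := indirect_le1 v xy.
by have : 0 <= indirect v y x; [apply: indirect_ge0; rewrite // eq_sym|lra].
Qed.

End IndirectScores.

(** * Cuts and the separation of two elements *)

Section Separation.
Context {R : realType} {A : finType}.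
Implicit Types (v : A -> A -> R) (U X : {set A}).

(** For the sets used in [separation] some pair leaves [U], and margins of a Llull matrix are at
    most 1, so the default value does not affect the minimum there. *)
Definition cut v U : R :=
  \big[Num.min/1]_(ab : A * A | (ab.1 \in U) && (ab.2 \notin U))
    margin v ab.1 ab.2.

Definition separation v x y : R :=
  \big[Num.max/0]_(U : {set A} | (x \in U) && (y \notin U)) cut v U.

Lemma cut_geP v U c :
  (c <= cut v U) <->
  c <= 1 /\ (forall a b, a \in U -> b \notin U -> c <= margin v a b).
Proof.
split.
  move/bigmin_geP=> [c1 cU]; split=> // a b aU bU.
  by apply: (cU (a, b)); rewrite /= aU bU.
by move=> [c1 cU]; apply/bigmin_geP; split=> // -[a b] /andP[] /=; exact: cU.
Qed.

Lemma separation_geP v x y c : 0 < c ->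
  (c <= separation v x y) <->
  c <= 1 /\ exists U, [/\ x \in U, y \notin U &
      forall a b, a \in U -> b \notin U -> c <= margin v a b].
Proof.
move=> c0; split.
  move/bigmax_geP=> [|[U /andP[xU yU] /cut_geP[c1 cU]]]; first by rewrite leNgt c0.
  by split=> //; exists U.
move=> [c1 [U [xU yU cU]]]; apply/bigmax_geP; right; exists U; first by rewrite xU.
by apply/cut_geP.
Qed.

Lemma separation_ge0 v x y : 0 <= separation v x y.
Proof. by apply/bigmax_geP; left. Qed.

(** The pair [(y, x)] leaves every set that competes for [separation v y x], and its margin is not
    positive. *)
Lemma separation_opp v x y : 0 <= margin v x y -> separation v y x = 0.
Proof.
move=> m0; apply/eqP; rewrite eq_le separation_ge0 andbT leNgt; apply/negP => s0.
have [_ [U [yU xU cU]]] := (separation_geP v y x s0).1 (lexx _).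
by have := cU _ _ yU xU; rewrite marginC; lra.
Qed.

End Separation.

(** * Initial segments and consecutive elements in finite strict total orders *)

Section StrictTotalOrders.
Context {A : finType}.
Implicit Types (xi : rel A) (U : {set A}).

Definition strict_total xi :=
  [/\ irreflexive xi, transitive xi & forall x y, x != y -> xi x y || xi y x].

Definition upper xi U := forall a b, xi a b -> b \in U -> a \in U.

Lemma strict_total_neq xi x y : strict_total xi -> xi x y -> x != y.
Proof. by move=> [irr _ _]; apply: contraTneq => ->; rewrite irr. Qed.

Lemma strict_total_asym xi x y : strict_total xi -> xi x y -> ~~ xi y x.
Proof.
by move=> [irr tr _] xy; apply/negP => yx; have := tr _ _ _ xy yx; rewrite irr.
Qed.

Lemma weakly_lt_trans xi x y z :
  strict_total xi -> weakly xi x y -> xi y z -> xi x z.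
Proof. by move=> [_ tr _] /predU1P[->|/tr]; last exact. Qed.

Lemma lt_weakly_trans xi x y z :
  strict_total xi -> xi x y -> weakly xi y z -> xi x z.
Proof. by move=> [_ tr _] xy /predU1P[<- //|]; exact: tr. Qed.

Lemma weaklyPn xi x y : strict_total xi -> ~~ weakly xi x y -> xi y x.
Proof.
by move=> [_ _ tot]; rewrite negb_or => /andP[/tot/orP[->|]].
Qed.

Lemma upper_weakly xi x : strict_total xi -> upper xi [set a | weakly xi a x].
Proof.
move=> st a b ab; rewrite !inE => bx.
by rewrite /weakly (lt_weakly_trans st ab bx) orbT.
Qed.

Lemma isucc_weakly xi p p' y :
  strict_total xi -> isucc xi p p' -> xi p y -> weakly xi p' y.
Proof.
move=> st /andP[_ /forallP/(_ y)] + py; rewrite py /= => yp'.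
by apply: contraR yp' => /(weaklyPn st).
Qed.

(** The last element of the initial segment [U] and the first element outside it are consecutive. *)
Lemma upper_crossing xi U x y :
  strict_total xi -> upper xi U -> x \in U -> y \notin U ->
  exists p p',
    [/\ p \in U, p' \notin U, isucc xi p p', weakly xi x p & xi p y].
Proof.
move=> st up xU yU; have [irr tr tot] := st.
(* Counting predecessors turns [xi] into the order of the naturals, so that last and first elements
   are obtained by [arg_max] and [arg_min]. *)
pose rk a := #|[set b | xi b a]|.
have rk_lt a b : xi a b -> (rk a < rk b)%N.
  move=> ab; apply/proper_card/properP; split.
    by apply/subsetP => c; rewrite !inE => /tr; apply.
  by exists a; rewrite !inE ?irr.
have out a b : a \in U -> b \notin U -> xi a b.
  move=> aU bU; have /tot/orP[//|ba] : a != b by apply: contraNneq bU => <-.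
  by rewrite (up _ _ ba aU) in bU.
have [p pU pmax] := arg_maxnP rk xU.
have [p' p'U p'min] := @arg_minnP _ y [pred b | b \notin U] rk yU.
exists p, p'; split=> //; last exact: out.
  rewrite /isucc out //=; apply/forallP => z; apply/negP => /andP[pz zp'].
  have [zU|zU] := boolP (z \in U).
    by have := pmax _ zU; rewrite /= leqNgt rk_lt.
  by have := p'min _ zU; rewrite /= leqNgt rk_lt.
apply/negPn/negP => /(weaklyPn st)/rk_lt.
by rewrite ltnNge => /negP[]; exact: pmax.
Qed.

Lemma exists_pred xi x y : strict_total xi -> xi x y ->
  exists2 r, weakly xi x r & isucc xi r y.
Proof.
move=> st xy; have [irr tr tot] := st.
have [||| p [p' [pU p'U pp' xp py]]] := @upper_crossing xi [set a | xi a y] x y st.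
- by move=> a b ab; rewrite !inE => /(tr _ _ _ ab).
- by rewrite inE.
- by rewrite inE irr.
exists p => //; have /predU1P[<- //|p'y] := isucc_weakly st pp' py.
by rewrite inE p'y in p'U.
Qed.

Lemma exists_succ xi x y : strict_total xi -> xi x y ->
  exists2 r, isucc xi x r & weakly xi r y.
Proof.
move=> st xy.
have [||p [p' [pU p'U pp' xp py]]] :=
    @upper_crossing xi [set a | weakly xi a x] x y st (upper_weakly st).
- by rewrite inE /weakly eqxx.
- rewrite inE negb_or eq_sym (strict_total_neq st xy).
  exact: strict_total_asym.
have -> : x = p.
  move: pU; rewrite inE => /predU1P[-> //|px].
  have /negP := strict_total_asym st px.
  by case/predU1P: xp => [//|xp]; case.
by exists p' => //; exact: (isucc_weakly st pp' py).
Qed.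

End StrictTotalOrders.

(** * Projected margins of consecutive pairs compared with separations *)

Section ProjectedMargins.
Context {R : realType} {A : finType}.
Variables (v : A -> A -> R) (xi : rel A).
Hypotheses (vL : llull v) (adm : admissible v xi).

Lemma admissible_strict_total : strict_total xi.
Proof. by have [? ? ? _ _] := adm. Qed.
Let st := admissible_strict_total.

Lemma admissible_margin_ge0 x y : xi x y -> 0 <= margin v x y.
Proof. by have [_ _ _ _] := adm; apply. Qed.

Lemma proj_margin_geP x y c :
  (c <= proj_margin v xi x y) <->
  (forall p q, weakly xi p x -> weakly xi y q -> c <= margin v p q).
Proof.
split.
  move/bigmin_geP=> [_ h] p q px yq; by apply: (h (p, q)); rewrite /= px yq.
move=> h; apply/bigmin_geP; split; first by apply: h; rewrite /weakly eqxx.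
by move=> -[p q] /andP[] /=; exact: h.
Qed.

Lemma proj_margin_ge0 x y : xi x y -> 0 <= proj_margin v xi x y.
Proof.
move=> xy; apply/proj_margin_geP => p q px yq; apply: admissible_margin_ge0.
exact: weakly_lt_trans st px (lt_weakly_trans st xy yq).
Qed.

Lemma proj_margin_le1 x y : xi x y -> proj_margin v xi x y <= 1.
Proof.
move=> xy; apply: le_trans (margin_le1 vL (strict_total_neq st xy)).
by apply: (proj_margin_geP x y _).1; rewrite ?lexx // /weakly eqxx.
Qed.

(** The initial segment ending at [p] separates [x] from [y], and all pairs leaving it lie in the
    range of the minimum that defines the projected margin. *)
Lemma proj_margin_le_separation x y p p' :
  isucc xi p p' -> weakly xi x p -> xi p y ->
  proj_margin v xi p p' <= separation v x y.
Proof.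
move=> pp' xp py; have [m0|m0] := leP (proj_margin v xi p p') 0.
  exact: le_trans m0 (separation_ge0 _ _ _).
apply/separation_geP => //; split.
  by apply: proj_margin_le1; case/andP: pp'.
exists [set a | weakly xi a p]; rewrite !inE; split=> //.
  by rewrite negb_or eq_sym (strict_total_neq st py) (strict_total_asym st).
move=> a b; rewrite !inE => ap /(weaklyPn st) pb.
by apply: (proj_margin_geP p p' _).1 => //; exact: isucc_weakly pb.
Qed.

(** An admissible order never ranks a pair against a positive margin. *)
Lemma positive_cut_upper (U : {set A}) c : 0 < c ->
  (forall a b, a \in U -> b \notin U -> c <= margin v a b) -> upper xi U.
Proof.
move=> c0 cU a b /admissible_margin_ge0 m0 bU; apply: contraT => aU.
by have := cU _ _ bU aU; rewrite marginC; lra.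
Qed.

Lemma le_proj_margin (U : {set A}) p p' c : upper xi U -> p \in U -> p' \notin U ->
  (forall a b, a \in U -> b \notin U -> c <= margin v a b) ->
  c <= proj_margin v xi p p'.
Proof.
move=> up pU p'U cU; apply/proj_margin_geP => a b ap p'b; apply: cU.
  by case/predU1P: ap => [-> //|/up]; apply.
by apply: contra p'U; case/predU1P: p'b => [-> //|/up]; apply.
Qed.

(** A set realizing a positive separation is an initial segment, and the consecutive pair at which
    the order leaves it has the required projected margin. *)
Lemma separation_attained x y : xi x y ->
  exists p p', [/\ isucc xi p p', weakly xi x p, xi p y
    & proj_margin v xi p p' = separation v x y].
Proof.
move=> xy.
suff [p [p' [pp' xp py h]]] : exists p p', [/\ isucc xi p p', weakly xi x p,
    xi p y & separation v x y <= proj_margin v xi p p'].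
  exists p, p'; split=> //; apply/eqP.
  by rewrite eq_le h proj_margin_le_separation.
(* With separation 0 any consecutive pair in between will do, since projected margins are
   nonnegative; the one starting at [x] is taken. *)
have := separation_ge0 v x y; rewrite le_eqVlt => /predU1P[<-|s0].
  have [p' xp' _] := exists_succ st xy; exists x, p'.
  by split=> //; [rewrite /weakly eqxx|apply: proj_margin_ge0; case/andP: xp'].
have [_ [U [xU yU cU]]] := (separation_geP v x y s0).1 (lexx _).
have up := positive_cut_upper s0 cU.
have [p [p' [pU p'U pp' xp py]]] := upper_crossing st up xU yU.
by exists p, p'; split=> //; exact: le_proj_margin cU.
Qed.

End ProjectedMargins.

(** * Bounds on feasible turnovers and on the intervals [gamma] *)

Section ProjectedScores.
Context {R : realType} {A : finType}.
Variables (v : A -> A -> R) (xi : rel A) (tau : A -> A -> R).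
Hypotheses (vL : llull v) (adm : admissible v xi).
Let st := admissible_strict_total adm.

Lemma gammaE x y z : gamma v xi tau x y z <->
  exists p p', [/\ weakly xi x p, xi p y, isucc xi p p' &
    (tau p p' - proj_margin v xi p p') / 2 <= z
      <= (tau p p' + proj_margin v xi p p') / 2].
Proof.
split=> [[[p p'] /= /and3P[xp py pp']]|[p [p' [xp py pp' zI]]]].
  by rewrite mem_setE in_itv => zI; exists p, p'.
by exists (p, p'); rewrite /= ?xp ?py // mem_setE in_itv.
Qed.

Section Feasible.
Hypothesis feas : feasible v xi tau.

(** Moving [y] up to its predecessor can only raise the turnover, until [y] is the successor of [x],
    where the bound 1 is a constraint. *)
Lemma feasible_le1 x y : xi x y -> tau x y <= 1.
Proof.
have [_ fs fd] := feas; have [n] := ubnP #|[set b | xi b y]|.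
elim: n y => // n IHn y le_n xy; have [r xr ry] := exists_pred st xy.
have ry' : xi r y by case/andP: ry.
case/predU1P: xr => [->|xr]; first by case/andP: (fs _ _ ry).
have /andP[+ _] := fd _ _ _ ry (strict_total_neq st xr) (strict_total_neq st xy).
rewrite subr_ge0 => /le_trans; apply; apply: IHn => //.
rewrite ltnS in le_n; apply: leq_trans le_n; apply/proper_card/properP.
have [irr tr _] := st; split.
  by apply/subsetP => c; rewrite !inE => /tr; apply.
by exists r; rewrite !inE ?irr.
Qed.

(** Moving [x] down to its successor can only lower the turnover, until the pair is consecutive and
    a nonnegative projected margin bounds it from below. *)
Lemma feasible_ge0 x y : xi x y -> 0 <= tau x y.
Proof.
have [fC fs fd] := feas; have [n] := ubnP #|[set b | xi x b]|.
elim: n x => // n IHn x le_n xy; have [r xr ry] := exists_succ st xy.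
have xr' : xi x r by case/andP: xr.
case/predU1P: ry => [<-|ry].
  by case/andP: (fs _ _ xr) => + _; apply/le_trans/(proj_margin_ge0 adm).
have yx : y != x by rewrite eq_sym (strict_total_neq st xy).
have yr : y != r by rewrite eq_sym (strict_total_neq st ry).
have /andP[+ _] := fd _ _ _ xr yx yr.
rewrite subr_ge0 -(fC r y) 1?eq_sym // -(fC x y) 1?eq_sym //.
apply: le_trans; apply: IHn => //.
rewrite ltnS in le_n; apply: leq_trans le_n; apply/proper_card/properP.
have [irr tr _] := st; split.
  by apply/subsetP => c; rewrite !inE; exact: tr.
by exists r; rewrite !inE ?irr.
Qed.

Lemma gamma_sub01 x y z : gamma v xi tau x y z -> 0 <= z <= 1.
Proof.
have [_ fs _] := feas; move=> /gammaE[p [p' [_ _ pp']]].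
have := proj_margin_le1 vL adm (proj1 (andP pp')).
by have := fs _ _ pp'; lra.
Qed.

End Feasible.

Lemma gamma_endpoints x y p p' :
  isucc xi p p' -> weakly xi x p -> xi p y ->
  gamma v xi tau x y ((tau p p' - proj_margin v xi p p') / 2) /\
  gamma v xi tau x y ((tau p p' + proj_margin v xi p p') / 2).
Proof.
move=> pp' xp py; have := proj_margin_ge0 adm (proj1 (andP pp')) => m0.
by split; apply/gammaE; exists p, p'; split=> //; lra.
Qed.

End ProjectedScores.

(** * Projected scores for a unanimous set with unit turnovers *)

Section UnanimousProjection.
Context {R : realType} {A : finType}.
Variables (v : A -> A -> R) (X : {set A}).
Hypotheses (vL : llull v) (vX : unanimous v X).
Hypothesis vX1 : forall x y, x \in X -> x != y -> turnover v x y = 1.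

Lemma unanimous_upper xi : admissible v xi -> upper xi X.
Proof.
move=> adm; apply: (positive_cut_upper adm (@ltr01 R)) => a b aX bX.
by rewrite (unanimous_margin vL vX).
Qed.

(* Raising to 1 all the turnovers that involve X keeps the feasibility and
   brings them to their targets, so the minimizer already has them equal to 1. *)
Lemma proj_turnover1 xi tau x y :
  admissible v xi -> proj_turnover v xi tau ->
  x \in X -> x != y -> tau x y = 1.
Proof.
move=> adm [feas tmin] xX xy.
have st := admissible_strict_total adm; have up := unanimous_upper adm.
pose tau' a b := if (a \in X) || (b \in X) then 1 else tau a b.
have [fC fs fd] := feas.
have turn1 a b : a != b -> (a \in X) || (b \in X) -> turnover v a b = 1.
  move=> ab /orP[/vX1|bX]; first exact.
  by rewrite /turnover addrC; apply: vX1; rewrite // eq_sym.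
have feas' : feasible v xi tau'.
  split.
  - by move=> a b ab; rewrite /tau' orbC fC.
  - move=> a b ab; rewrite /tau'; case: ifP => _; last exact: fs.
    by rewrite lexx (proj_margin_le1 vL adm) //; case/andP: ab.
  - move=> a b b' bb' ab ab'; rewrite /tau'.
    have bb'1 : xi b b' by case/andP: bb'.
    have m0 := proj_margin_ge0 adm bb'1.
    have [aX|aX] /= := boolP (a \in X); first by rewrite subrr lexx m0.
    have [b'X|b'X] := boolP (b' \in X).
      by rewrite (up _ _ bb'1 b'X) subrr lexx m0.
    (* The critical case: [b] ends [X] and [a] lies below [b']. The new difference is
       [1 - tau a b'], which lies in [0, 1], and the projected margin across the border of [X] is at
       least 1. *)
    have [bX|bX] := boolP (b \in X); last exact: fd.
    have ba : xi b a.
      apply: (weaklyPn st); apply: contraNN aX => /predU1P[-> //|/up]; exact.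
    have b'a : xi b' a.
      have /predU1P[b'a|//] := isucc_weakly st bb' ba.
      by rewrite b'a eqxx in ab'.
    have m1 : 1 <= proj_margin v xi b b'.
      apply: (le_proj_margin up bX b'X) => c d cX dX.
      by rewrite (unanimous_margin vL vX).
    rewrite fC //; have := feasible_le1 adm feas b'a.
    by have := feasible_ge0 adm feas b'a; lra.
have term_ge0 a b : b != a ->
    0 <= (tau a b - turnover v a b) ^+ 2 - (tau' a b - turnover v a b) ^+ 2.
  move=> ba; rewrite /tau'; case: ifPn => [abX|_]; last by rewrite subrr.
  by rewrite turn1 1?eq_sym // subrr expr0n subr0 sqr_ge0.
(* Minimality makes a sum of nonnegative terms at most 0, so each term vanishes; the one at [(x, y)]
   is [(tau x y - 1) ^+ 2]. *)
have := tmin _ feas'; rewrite -subr_le0 /sq_dist -sumrB.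
under eq_bigr do rewrite -sumrB.
have in_ge0 a : 0 <= \sum_(b | b != a)
    ((tau a b - turnover v a b) ^+ 2 - (tau' a b - turnover v a b) ^+ 2).
  by apply: sumr_ge0 => b; exact: term_ge0.
move=> le0; have /psumr_eq0P eq0 : \sum_a \sum_(b | b != a)
    ((tau a b - turnover v a b) ^+ 2 - (tau' a b - turnover v a b) ^+ 2) = 0.
  by apply/eqP; rewrite eq_le le0 sumr_ge0.
have /psumr_eq0P eq0x := eq0 (fun a _ => in_ge0 a) x isT.
have yx : y != x by rewrite eq_sym.
have := eq0x (fun b => @term_ge0 x b) y yx.
rewrite /tau' xX /= vX1 // subrr expr0n subr0 => /eqP.
by rewrite sqrf_eq0 subr_eq0 => /eqP.
Qed.

(** The turnovers between [x] and [y] being 1, [gamma] is a union of intervals centred at 1/2, and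
    the widest one has length equal to the separation. The separation in the direction opposite to
    the order is 0, which gives one formula for both directions. *)
Lemma projected_inside vpi x y : projected v vpi -> x \in X -> y \in X -> x != y ->
  vpi x y = (1 + separation v x y - separation v y x) / 2.
Proof.
move=> [xi [tau [adm pt vpiE]]] xX yX xy.
have st := admissible_strict_total adm; have up := unanimous_upper adm.
suff P a b : a \in X -> b \in X -> xi a b ->
    sup (gamma v xi tau a b) = (1 + separation v a b) / 2 /\
    inf (gamma v xi tau a b) = (1 - separation v a b) / 2.
  rewrite vpiE // /proj_of; case: ifPn => xiE.
    have [-> _] := P _ _ xX yX xiE.
    by rewrite [separation v y x]separation_opp ?subr0 // (admissible_margin_ge0 adm).
  have yx : xi y x by have [_ _ tot] := st; have := tot _ _ xy; rewrite (negPf xiE).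
  have [_ ->] := P _ _ yX xX yx.
  by rewrite [separation v x y]separation_opp ?addr0 // (admissible_margin_ge0 adm).
move=> aX bX ab.
have tau1 p p' : isucc xi p p' -> xi p b -> tau p p' = 1.
  move=> /andP[pp' _] pb; apply: (proj_turnover1 adm pt); first exact: up bX.
  exact: strict_total_neq pp'.
have gbnd z : gamma v xi tau a b z ->
    (1 - separation v a b) / 2 <= z <= (1 + separation v a b) / 2.
  move=> /gammaE[p [p' [ap pb pp']]]; rewrite tau1 //.
  by have := proj_margin_le_separation vL adm pp' ap pb; lra.
have [p [p' [pp' ap pb mE]]] := separation_attained vL adm ab.
have [] := gamma_endpoints tau adm pp' ap pb; rewrite mE tau1 // => gm gM.
split; apply/eqP; rewrite eq_le; apply/andP; split.
- by apply: ge_sup => [|z /gbnd/andP[]//]; exists ((1 + separation v a b) / 2).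
- by apply: ub_le_sup => //; exists ((1 + separation v a b) / 2) => z /gbnd/andP[].
- by apply: ge_inf => //; exists ((1 - separation v a b) / 2) => z /gbnd/andP[].
- by apply: lb_le_inf => [|z /gbnd/andP[]//]; exists ((1 - separation v a b) / 2).
Qed.

(** At the border of [X] both the projected margin and the turnover are 1, so [gamma] contains the
    interval [0, 1], whose minimum is 0. *)
Lemma projected_enter vpi x y :
  projected v vpi -> x \in X -> y \notin X -> vpi y x = 0.
Proof.
move=> [xi [tau [adm pt vpiE]]] xX yX.
have st := admissible_strict_total adm; have up := unanimous_upper adm.
have yx : y != x by apply: contraNneq yX => ->.
have xiyx : ~~ xi y x by apply: contraNN yX => /up; apply.
have [p [p' [pX p'X pp' xp py]]] := upper_crossing st up xX yX.
have m1 : proj_margin v xi p p' = 1.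
  apply/eqP; rewrite eq_le (proj_margin_le1 vL adm) ?(proj1 (andP pp')) //=.
  by apply: (le_proj_margin up pX p'X) => c d cX dX; rewrite (unanimous_margin vL vX).
have := (gamma_endpoints tau adm pp' xp py).1.
rewrite m1 (proj_turnover1 adm pt pX) ?(strict_total_neq st) ?(proj1 (andP pp')) //.
rewrite subrr mul0r => g0.
rewrite vpiE // /proj_of (negPf xiyx); apply/eqP; rewrite eq_le; apply/andP; split.
  by apply: ge_inf g0; exists 0 => z /(gamma_sub01 vL adm pt.1)/andP[].
by apply: lb_le_inf => [|z /(gamma_sub01 vL adm pt.1)/andP[]//]; exists 0.
Qed.

End UnanimousProjection.

(** * Restriction to a unanimous set *)

Section Restriction.
Context {R : realType} {A : finType}.
Variables (v : A -> A -> R) (X : {set A}).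
Hypotheses (vL : llull v) (vX : unanimous v X).
Local Notation T := {x : A | x \in X}.
Local Notation vT := (restrict v : T -> T -> R).

Lemma restrict_llull : llull vT.
Proof. by move=> x y xy; apply: vL; rewrite (inj_eq val_inj). Qed.

Lemma path_score_restrict (x : T) (s : seq T) :
  path_score vT x s = path_score v (val x) (map val s).
Proof.
elim: s x => [|y s IHs] x /=; first by rewrite /path_score !big_nil.
by rewrite !path_score_cons IHs.
Qed.

(** After a vertex outside [X] the path has to enter [X] again, through a zero entry. *)
Lemma path_score_outside x s :
  last x s \in X -> ~~ all (mem X) s -> path_score v x s <= 0.
Proof.
elim: s x => [|y s IHs] x //= ls; rewrite negb_and path_score_cons ge_min.
have [yX /= sX|yX _] := boolP (y \in X); first by rewrite IHs ?orbT.
rewrite (@path_score_enter _ _ _ X) ?orbT // => a b aX bX.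
by rewrite (unanimous_opp vL vX).
Qed.

Lemma indirect_restrict (x y : T) :
  x != y -> indirect vT x y = indirect v (val x) (val y).
Proof.
move=> xy; have vxy : val x != val y by rewrite (inj_eq val_inj).
apply/eqP; rewrite eq_le; apply/andP; split; apply: indirect_le => // s ps ls.
  have [s0|s0] := eqVneq s [::]; first by rewrite -ls s0 eqxx in xy.
  rewrite path_score_restrict; apply: indirect_ge.
  - by case: s s0 {ps ls}.
  - by rewrite path_map; apply: sub_path ps => a b; rewrite /= (inj_eq val_inj).
  - by rewrite last_map ls.
have [sX|sX] := boolP (all (mem X) s); last first.
  apply: le_trans (path_score_outside _ sX) (indirect_ge0 restrict_llull xy).
  by rewrite ls (valP y).
have [s' s'E] : exists s' : seq T, s = map val s'.
  elim: {ps ls} s sX => [|a s IHs] /=; first by exists [::].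
  by case/andP=> aX /IHs[s' ->]; exists (Sub a aX :: s').
rewrite s'E -path_score_restrict; apply: indirect_ge.
- by apply: contraTneq vxy => s'0; rewrite -ls s'E s'0 /= eqxx.
- move: ps; rewrite s'E path_map; apply: sub_path => a b.
  by rewrite /= (inj_eq val_inj).
- by apply: val_inj; rewrite -last_map -s'E.
Qed.

Lemma margin_restrict (x y : T) : margin vT x y = margin v (val x) (val y).
Proof.
have [->|xy] := eqVneq x y; first by rewrite /margin !subrr.
by rewrite /margin !indirect_restrict // eq_sym.
Qed.

(** A separating set inside [X] still works in [A], because the additional outgoing pairs leave [X]
    and have margin 1; conversely a separating set of [A] is intersected with [X]. *)
Lemma separation_restrict (x y : T) :
  separation vT x y = separation v (val x) (val y).
Proof.
apply/eqP; rewrite eq_le; apply/andP; split.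
  have [s0|s0] := leP (separation vT x y) 0.
    exact: le_trans s0 (separation_ge0 _ _ _).
  have [s1 [U [xU yU sU]]] := (separation_geP vT x y s0).1 (lexx _).
  apply/separation_geP => //; split=> //; exists (val @: U).
  rewrite !(mem_imset _ _ val_inj); split=> // _ b /imsetP[a aU ->] bU.
  have [bX|bX] := boolP (b \in X); last first.
    by rewrite (unanimous_margin vL vX) // (valP a).
  rewrite -[b]/(val (Sub b bX : T)) -margin_restrict; apply: sU => //.
  by rewrite -(mem_imset _ _ val_inj).
have [s0|s0] := leP (separation v (val x) (val y)) 0.
  exact: le_trans s0 (separation_ge0 _ _ _).
have [s1 [U [xU yU sU]]] := (separation_geP v _ _ s0).1 (lexx _).
apply/separation_geP => //; split=> //; exists [set a | val a \in U].
rewrite !inE; split=> // a b; rewrite !inE margin_restrict; exact: sU.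
Qed.

(** This lets the results on the top component be applied to the restricted problem, with its whole
    set in the role of [X]. *)
Lemma condP_restrict : condP v X -> condP vT [set: T].
Proof.
move=> [_ min]; split; first by move=> x y _; rewrite inE.
move=> [U [U0 UT uU]]; apply: min; exists (val @: U); split.
- by rewrite card_imset //; exact: val_inj.
- have /properP[_ [b _ bU]] := UT; apply/properP; split.
    by apply/subsetP => _ /imsetP[a _ ->]; exact: valP.
  by exists (val b); rewrite ?(valP b) // (mem_imset _ _ val_inj).
move=> _ b /imsetP[a aU ->] bU.
have [bX|bX] := boolP (b \in X); last by apply: vX => //; exact: valP.
by apply: (uU a (Sub b bX)) => //; rewrite -(mem_imset _ _ val_inj).
Qed.

End Restriction.

(** * The top dominant component is the minimal unanimous set *)

Section TopComponent.
Context {R : realType} {A : finType}.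
Variables (v : A -> A -> R) (X : {set A}).
Hypotheses (vL : llull v) (vX : unanimous v X).
Hypothesis vX1 : forall x y, x \in X -> x != y -> turnover v x y = 1.

Lemma reach_enter (vpi : A -> A -> R) (U : {set A}) x y :
  (forall a b, a \in U -> b \notin U -> vpi b a = 0) ->
  x \in U -> y \notin U -> ~~ reach vpi y x.
Proof.
move=> U0 xU yU; apply/negP => /connectP[s ps ls].
elim: s y yU ps ls => [|z s IHs] y yU /=; first by move=> _ xy; rewrite -xy xU in yU.
case/andP=> /andP[_ yz] ps ls; apply: (IHs z) => //.
by apply/negP => zU; rewrite U0 ?ltxx in yz.
Qed.

(** Unreachability forces [vpi y x <= 0]; in the formula for the scores inside [X] this is possible
    only with full separation. *)
Lemma separated_unreachable vpi x y : projected v vpi ->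
  x \in X -> y \in X -> x != y -> ~~ reach vpi y x -> 1 <= separation v x y.
Proof.
move=> pv xX yX xy yx; have yx' : y != x by rewrite eq_sym.
have : vpi y x <= 0.
  rewrite leNgt; apply: contra yx => v0; apply: connect1.
  by rewrite yx' v0.
rewrite (projected_inside vL vX vX1 pv yX xX yx').
by have := separation_ge0 v y x; lra.
Qed.

Lemma separated_unanimous x y :
  x \in X -> y \in X -> x != y -> 1 <= separation v x y ->
  exists U : {set A}, [/\ x \in U, y \notin U, U \subset X & unanimous v U].
Proof.
move=> xX yX xy /(separation_geP v x y (@ltr01 R))[_ [U [xU yU cU]]].
have sUX : U \subset X.
  (* An [a] in [U] outside [X] would have margin at least 1 over [y], whereas [y], being in [X], has
     margin 1 over [a]. *)
  apply/subsetP => a aU; apply: contraT => aX.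
  have := cU a y aU yU; rewrite marginC (unanimous_margin vL vX yX aX); lra.
exists U; split=> // a b aU bU; have ab : a != b by apply: contraNneq bU => <-.
have := vX1 (subsetP sUX a aU) ab.
by rewrite /turnover (margin_ge1_opp vL ab (cU a b aU bU)) addr0.
Qed.

Lemma top_component_sub vpi Z : X != set0 ->
  projected v vpi -> top_component vpi Z -> Z \subset X.
Proof.
move=> /set0Pn[x xX] pv [_ Zin Zout _]; apply/subsetP => z zZ.
apply: contraT => zX; have zx : z != x by apply: contraNneq zX => ->.
have /negP[] : ~~ reach vpi z x.
  by apply: (@reach_enter _ X) => // a b; exact: projected_enter pv.
by have [xZ|xZ] := boolP (x \in Z); [apply: Zin|apply: Zout].
Qed.

(** An element of [X] outside [Z] cannot reach [Z], so full separation yields a smaller unanimous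
    set, against minimality. *)
Lemma top_component_eq vpi Z : X != set0 -> condP v X ->
  projected v vpi -> top_component vpi Z -> Z = X.
Proof.
move=> X0 [_ min] pv tZ; have sZX := top_component_sub X0 pv tZ.
apply/eqP; rewrite eqEsubset sZX /=; apply/subsetP => y yX; apply: contraT => yZ.
have [/card_gt0P[z zZ] _ _ Zenter] := tZ; have zX := subsetP sZX z zZ.
have zy : z != y by apply: contraNneq yZ => <-.
have s1 := separated_unreachable pv zX yX zy (Zenter _ _ zZ yZ).
have [U [zU yU sUX uU]] := separated_unanimous zX yX zy s1.
case: min; exists U; split=> //; first by apply/card_gt0P; exists z.
by apply/properP; split=> //; exists y.
Qed.

End TopComponent.

(** * Uniqueness of Zermelo's rates under unit turnovers *)

Section RatesUniqueness.
Context {R : realType} {A : finType}.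
Implicit Types (vpi : A -> A -> R) (phi psi : A -> R) (X : {set A}).

(* At an element where [phi / psi] is maximal every summand of its equation is
   at least as large for [phi] as for [psi], so that the ratio is constant. *)
Lemma rates_on_unique f vpi X phi psi :
  f != 0 ->
  (forall x y, x \in X -> y \in X -> x != y -> turnover vpi x y = 1) ->
  rates_on f vpi X phi -> rates_on f vpi X psi ->
  {in X, phi =1 psi}.
Proof.
move=> f0 t1 [_ phi0 phif phiE] [_ psi0 psif psiE] x0 x0X.
have [x xX xmax] := @arg_maxP _ _ _ x0 (mem X) (fun a => phi a / psi a) x0X.
have px := phi0 _ xX; have qx := psi0 _ xX.
have ratio y : y \in X -> phi y * psi x <= phi x * psi y.
  move=> yX; have := xmax _ yX; have qy := psi0 _ yX.
  by rewrite /= ler_pdivrMr // mulrAC ler_pdivlMr.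
have diffE y : y \in X ->
    phi x / (phi x + phi y) - psi x / (psi x + psi y)
    = (phi x * psi y - phi y * psi x) / ((phi x + phi y) * (psi x + psi y)).
  by move=> yX; have := phi0 _ yX; have := psi0 _ yX => qy py; field; apply/andP; lra.
have term_ge0 y : (y \in X) && (y != x) ->
    0 <= phi x / (phi x + phi y) - psi x / (psi x + psi y).
  case/andP=> yX _; rewrite diffE // divr_ge0 ?subr_ge0 ?ratio //.
  by have := phi0 _ yX; have := psi0 _ yX => qy py; rewrite mulr_ge0 ?addr_ge0 ?ltW.
have sumE : \sum_(y in X | y != x)
    (phi x / (phi x + phi y) - psi x / (psi x + psi y)) = 0.
  rewrite sumrB; apply/eqP; rewrite subr_eq0; apply/eqP.
  (* Both families satisfy the equation at [x] with the same right-hand side, so the left-hand sides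
     agree. *)
  move: (phiE _ xX); rewrite -(psiE _ xX) => eqx.
  have unit (g : A -> R) : \sum_(y in X | y != x) turnover vpi x y * g y =
      \sum_(y in X | y != x) g y.
    by apply: eq_bigr => y /andP[yX yx]; rewrite t1 ?mul1r // eq_sym.
  by rewrite !unit in eqx.
have ratioE y : y \in X -> phi y * psi x = phi x * psi y.
  move=> yX; have [->|yx] := eqVneq y x; first by [].
  have yXx : (y \in X) && (y != x) by rewrite yX yx.
  have := psumr_eq0P term_ge0 sumE yXx; rewrite diffE // => /eqP.
  have := phi0 _ yX; have := psi0 _ yX => qy py.
  rewrite mulf_eq0 invr_eq0 [X in _ || X]gt_eqF ?mulr_gt0 ?addr_gt0 // orbF.
  by rewrite subr_eq0 => /eqP.
(* The two families are proportional and have the same nonzero sum [f]. *)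
have xE : phi x = psi x.
  apply: (mulIf f0); rewrite -{1}psif -phif mulr_sumr mulrC mulr_suml.
  by apply: eq_bigr => y yX; rewrite ratioE.
by apply: (mulIf (lt0r_neq0 qx)); rewrite ratioE // xE mulrC.
Qed.

End RatesUniqueness.

(** * Collective matrices and ranking votes *)

Section CollectiveVotes.
Context {R : realType} {A K : finType}.
Variables (alpha : K -> R) (w : K -> A -> A -> R).
Hypotheses (wL : forall k, llull (w k)) (alpha_gt0 : forall k, 0 < alpha k).
Hypothesis alpha1 : \sum_(k : K) alpha k = 1.
Local Notation v := (collective alpha w).

Lemma collective_llull : llull v.
Proof.
have sum_le1 (g : K -> R) : (forall k, g k <= 1) -> \sum_k alpha k * g k <= 1.
  move=> g1; rewrite -[leRHS]alpha1; apply: ler_sum => k _.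
  by rewrite ler_piMr // ltW.
move=> x y xy; split; last first.
  rewrite /collective -big_split /=; under eq_bigr do rewrite -mulrDr.
  by apply: sum_le1 => k; case: (wL k xy).
apply/andP; split; last by apply: sum_le1 => k; exact: llull_le1.
by apply: sumr_ge0 => k _; apply: mulr_ge0; [exact: ltW|exact: llull_ge0].
Qed.

(** A mean with positive weights of numbers at most 1 equals 1 only if each of them does. *)
Lemma collective_eq1 x y k : x != y -> v x y = 1 -> w k x y = 1.
Proof.
move=> xy v1; have term_ge0 j : true -> 0 <= alpha j * (1 - w j x y).
  by move=> _; apply: mulr_ge0; [exact: ltW|rewrite subr_ge0 llull_le1].
have sum0 : \sum_j alpha j * (1 - w j x y) = 0.
  under eq_bigr do rewrite mulrBr mulr1.
  by rewrite sumrB alpha1; apply/eqP; rewrite subr_eq0 -[X in X == _]v1.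
have /eqP := psumr_eq0P term_ge0 sum0 (i := k) isT.
by rewrite mulf_eq0 gt_eqF //= subr_eq0 => /eqP <-.
Qed.

Lemma ranking_turnover1 (X : {set A}) x y :
  (forall k, ranking_vote (w k)) -> X \proper [set: A] -> unanimous v X ->
  x \in X -> x != y -> turnover v x y = 1.
Proof.
move=> rk /properP[_ [y0 _ y0X]] vX xX xy.
have [yX|yX] := boolP (y \in X); last first.
  by rewrite /turnover vX // (unanimous_opp collective_llull vX xX yX) addr0.
rewrite /turnover /collective -big_split -alpha1; apply: eq_bigr => k _ /=.
rewrite -mulrDr; have [L [r [tot _ wE]]] := rk k.
(* Every vote gives [z] the score 1 over the outside element [y0], which an unlisted [z] cannot get.
   Two listed elements always have turnover 1. *)
have inL z : z \in X -> z \in L.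
  move=> zX; have zy0 : z != y0 by apply: contraNneq y0X => <-.
  have := collective_eq1 k zy0 (vX _ _ zX y0X); rewrite wE // /ranking_score.
  by case: ifP => // _ /eqP; rewrite eq_sym oner_eq0.
have yx : y != x by rewrite eq_sym.
rewrite (wE _ _ xy) (wE _ _ yx) /ranking_score (inL _ xX) (inL _ yX).
by have := tot x y (inL _ xX) (inL _ yX); case: (r x y); case: (r y x) => //= _; field.
Qed.

End CollectiveVotes.

(** * The two implications between (P) and (Q) *)

Section Main.
Context {R : realType} {A : finType}.
Variables (v : A -> A -> R) (X : {set A}).
Variables (phi : A -> R) (phiX : {x : A | x \in X} -> R).
Hypotheses (vL : llull v) (X0 : X != set0).

Lemma condP_condQ :
  (1 < #|A|)%N -> (forall x y, x \in X -> x != y -> turnover v x y = 1) ->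
  rates 1 v phi -> rates 1 (restrict v) phiX -> condP v X -> condQ phi phiX.
Proof.
move=> A2 vX1 [[A1 _]|[_ [vpi [Z [pv _ tZ rZ]]]]]; first by rewrite A1 in A2.
move=> ratesX cP; have [vX _] := cP.
have ZX := top_component_eq vL vX vX1 X0 cP pv tZ.
rewrite {}ZX in rZ; have [phi0 phi_gt0 phi1 phiE] := rZ.
suff eqX (x : {x | x \in X}) : phi (val x) = phiX x.
  by split=> [x|//]; rewrite -eqX; split=> //; apply: phi_gt0; exact: valP.
move: phi1; rewrite big_sub => phi1.
(* When [X] is a singleton its only rate is the total 1, and so is the rate of that element in [A],
   since [phi] sums to 1 over [X]. *)
case: ratesX => [[X1 ->]|[_ [u [W [pu _ tW rW]]]]].
  have /eq_leq/fintype_le1P eq1 := X1.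
  by rewrite -phi1 (bigD1 x) //= big1 ?addr0 // => y; rewrite (eq1 x y) eqxx.
set vT := restrict v in pu.
have vTX1 (a b : {x | x \in X}) :
    a \in [set: {x | x \in X}] -> a != b -> turnover vT a b = 1.
  by move=> _ ab; apply: vX1; rewrite ?(valP a) // (inj_eq val_inj).
have vTX : unanimous vT [set: {x | x \in X}] by move=> a b _; rewrite inE.
have vTL : llull vT by exact: restrict_llull.
(* Inside [X] the projected scores depend only on separations, which restriction preserves; hence
   [phi] on [X] solves the equations of [phiX]. *)
have uE a b : a != b -> u a b = vpi (val a) (val b).
  move=> ab; rewrite (projected_inside vTL vTX vTX1 pu) ?inE //.
  rewrite (projected_inside vL vX vX1 pv (valP a) (valP b)) ?(inj_eq val_inj) //.
  by rewrite !(separation_restrict vL vX).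
have WE : W = [set: {x | x \in X}].
  apply: (top_component_eq vTL vTX vTX1 _ (condP_restrict vX cP) pu tW).
  by apply/set0Pn; exists x; rewrite inE.
rewrite WE in rW.
suff : {in [set: {x | x \in X}], phi \o val =1 phiX} by move=> /(_ x (in_setT x)).
apply: (@rates_on_unique _ _ 1 u) rW => //.
- exact: oner_neq0.
- move=> a b _ _ ab; rewrite /turnover !(projected_inside vTL vTX vTX1 pu) ?inE //.
    by field.
  by rewrite eq_sym.
split.
- by move=> a; rewrite inE.
- by move=> a _; apply: phi_gt0; exact: valP.
- by rewrite -phi1; apply: eq_bigl => a; rewrite inE.
move=> a _; have eqa := phiE _ (valP a); rewrite !big_sub_cond in eqa.
apply: etrans (etrans _ eqa) _; apply: eq_big => b;
  rewrite ?inE ?(inj_eq val_inj) //= => ba.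
  by rewrite /turnover !uE // eq_sym.
by rewrite uE // eq_sym.
Qed.

Lemma condQ_condP :
  (1 < #|A|)%N -> complete v -> rates 1 v phi -> condQ phi phiX -> condP v X.
Proof.
move=> A2 vC [[A1 _]|[_ [vpi [Z [pv _ tZ [phi0 phi_gt0 _ _]]]]]] [posX zeroX].
  by rewrite A1 in A2.
(* Both sets are the support of [phi]. *)
have ZX : Z = X.
  apply/setP => x; apply/idP/idP => [xZ|xX]; apply: contraT => xS.
    by have := phi_gt0 _ xZ; rewrite zeroX ?ltxx.
  by have [<-] := posX (exist _ x xX); rewrite /= phi0 ?ltxx.
rewrite {}ZX in tZ; have [_ Xin _ Xenter] := tZ.
(* The whole set is vacuously unanimous and completeness gives unit turnovers, so the formula for
   the projected scores holds on all of [A]. *)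
have vT : unanimous v [set: A] by move=> a b _; rewrite inE.
have vT1 a b : a \in [set: A] -> a != b -> turnover v a b = 1 by move=> _; exact: vC.
split=> [x y xX yX|[X' [/card_gt0P[x xX'] /properP[sX'X [y yX yX']] uX']]].
  have xy : x != y by apply: contraNneq yX => <-.
  have s1 := separated_unreachable vL vT vT1 pv (in_setT x) (in_setT y) xy
               (Xenter _ _ xX yX).
  have [U [xU yU _ uU]] := separated_unanimous vL vT vT1 (in_setT x) (in_setT y) xy s1.
  exact: uU.
have yx : y != x by apply: contraNneq yX' => ->.
(* A smaller unanimous [X'] could not be entered from the rest of [X], against the irreducibility of
   the top component. *)
have /negP[] : ~~ reach vpi y x; last by apply: Xin => //; apply: (subsetP sX'X).
apply: (@reach_enter _ _ vpi X') => // a b.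
by apply: (projected_enter vL uX' _ pv) => c d _; exact: vC.
Qed.

End Main.

Theorem theorem14p8 (R : realType) (A K : finType)
    (alpha : K -> R) (w : K -> A -> A -> R) (X : {set A})
    (phi : A -> R) (phiX : {x : A | x \in X} -> R) :
  (forall k, llull (w k)) ->
  (forall k, 0 < alpha k) ->
  \sum_(k : K) alpha k = 1 ->
  X != set0 ->
  X \proper [set: A] ->
  rates 1 (collective alpha w) phi ->
  rates 1 (restrict (collective alpha w)) phiX ->
  (complete (collective alpha w) \/ (forall k, ranking_vote (w k)) ->
     condP (collective alpha w) X -> condQ phi phiX) /\
  (complete (collective alpha w) ->
     condQ phi phiX -> condP (collective alpha w) X).
Proof.
move=> wL alpha_gt0 alpha1 X0 XA ratesA ratesX.
have vL := collective_llull wL alpha_gt0 alpha1.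
have A2 : (1 < #|A|)%N.
  by rewrite -cardsT; apply: leq_ltn_trans (proper_card XA); rewrite card_gt0.
split=> [full cP|vC]; last exact: (condQ_condP vL A2 vC ratesA).
apply: (condP_condQ vL X0 A2 _ ratesA ratesX cP) => x y xX xy.
case: full => [vC|rk]; first exact: vC.
exact: (ranking_turnover1 wL alpha_gt0 alpha1 rk XA cP.1).
Qed.
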